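(* Let $G_0 \xleftarrow{\varphi_0} G_1 \xleftarrow{\varphi_1} G_2 \xleftarrow{\varphi_2}\cdots$ be a sequence of covers of graphs with inverse limit $(X,f)$. Then the maps $p_*:\mathcal{M}_f\to\mathcal{I}_\infty$ and $p_*:\mathcal{P}_f\to\Delta_\infty$, $\mu\mapsto\bar\mu$, are isomorphisms; that is, each is a bijection that is linear (respectively affine, i.e. it respects non-negative linear, respectively convex, combinations) and a homeomorphism.
   Context: A graph is a pair $G=(V,E)$ with $V$ a finite set and $E \subseteq V\times V$ such that for each $v\in V$ there are edges $(u_1,v),(v,u_2)\in E$. A graph homomorphism $\varphi:(V_1,E_1)\to(V_2,E_2)$ is a map $\varphi:V_1\to V_2$ with $(\varphi\times\varphi)(E_1)\subseteq E_2$; for $e=(u,v)\in E_1$ write $\varphi(e)=(\varphi(u),\varphi(v))$. It is a cover if $(\varphi\times\varphi)(E_1)=E_2$ and $(u,v),(u,v')\in E_1$ implies $\varphi(v)=\varphi(v')$. In a sequence of covers, write $G_n=(V_n,E_n)$, $n\in\mathbb{N}=\{0,1,2,\dots\}$; each $\varphi_n:G_{n+1}\to G_n$ is a cover and $G_0=(\{0\},\{(0,0)\})$. For $m>n$, $\varphi_{m,n}:=\varphi_n\circ\cdots\circ\varphi_{m-1}$. The inverse limit $(X,f)$ is: $X=\{(x_0,x_1,\dots)\in\prod_i V_i : x_i=\varphi_i(x_{i+1})\ \forall i\}$ with the product topology, and $f:X\to X$ is the continuous surjection whose graph is $\{(x,y): (x_i,y_i)\in E_i\ \forall i\}$. For $v\in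 V_n$, $U(v)=\{x\in X:x_n=v\}$; for $e=(u,v)\in E_n$, $U(e)=U(u)\cap f^{-1}(U(v))$. $\mathcal{M}_f$ is the set of all $f$-invariant (finite, non-negative) Borel measures on $X$ and $\mathcal{P}_f$ the subset of probability measures, both with the weak topology. For a graph $G=(V,E)$, $\mathcal{I}(G)$ is the set of formal sums $\sum_{e\in E}a(e)e$ (elements of $\mathbb{R}^E$) with all $a(e)\ge0$ and, for every $v\in V$, $\sum_{(u,v)\in E}a((u,v))=\sum_{(v,u)\in E}a((v,u))$. $\mathcal{P}(G)$ is the subset of those with $\sum_e a(e)=1$. A cover $\varphi:G'\to G$ induces $\varphi_*:\mathcal{I}(G')\to\mathcal{I}(G)$, $\varphi_*(\sum a(e)e)=\sum a(e)\varphi(e)$, with $\varphi_*(\mathcal{P}(G'))\subseteq\mathcal{P}(G)$. Put $\Delta_n=\mathcal{P}(G_n)$ and $\xi_{m,n}=(\varphi_{m,n})_*|_{\Delta_m}:\Delta_m\to\Delta_n$. Then $\mathcal{I}_\infty=\{(x_0,x_1,\dots): x_i\in\mathcal{I}(G_i),\ (\varphi_{m,n})_*(x_m)=x_n\ \forall m>n\}$ and $\Delta_\infty=\{(x_0,x_1,\dots): x_i\in\Delta_i,\ \xi_{m,n}(x_m)=x_n\ \forall m>n\}$, both with the product topology. For $\mu\in\mathcal{M}_f$, $\bar\mu=(\mu_0,\mu_1,\dots)$ with $\mu_n=\sum_{e\in E_n}\mu(U(e))e$; this lies in $\mathcal{I}_\infty$, and in $\Delta_\infty$ if $\mu\in\mathcal{P}_f$.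 *)

(* Defs.v *)
From HB Require Import structures.
From mathcomp Require Import all_boot all_order all_algebra.
From mathcomp Require Import all_classical all_reals all_analysis.

Set Implicit Arguments.
Unset Strict Implicit.
Unset Printing Implicit Defensive.

Import Order.TTheory GRing.Theory Num.Theory.
Import numFieldNormedType.Exports.

Local Open Scope classical_set_scope.
Local Open Scope ring_scope.

Record graph := Graph {
  vertex :> finType;
  adj : rel vertex;
  adj_in : forall v, exists u, adj u v;
  adj_out : forall v, exists u, adj v u }.

Definition edge (G : graph) : finType := {e : G * G | adj e.1 e.2}.

Definition source (G : graph) (e : edge G) : G := (val e).1.
Definition target (G : graph) (e : edge G) : G := (val e).2.

Record graph_hom (G1 G2 : graph) := Hom {
  hom_fun :> G1 -> G2;
  hom_adj : forall u v, adj u v -> adj (hom_fun u) (hom_fun v) }.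

Definition hom_edge (G1 G2 : graph) (phi : graph_hom G1 G2) (e : edge G1) : edge G2 :=
  exist (fun e : G2 * G2 => adj e.1 e.2) (phi (source e), phi (target e))
    (hom_adj phi (valP e)).

Definition hom_id (G : graph) : graph_hom G G := Hom (fun u v (h : adj u v) => h).

Definition hom_comp (G1 G2 G3 : graph) (psi : graph_hom G2 G3) (phi : graph_hom G1 G2) :
    graph_hom G1 G3 :=
  Hom (fun u v (h : adj u v) => hom_adj psi (hom_adj phi h)).

Definition is_cover (G1 G2 : graph) (phi : graph_hom G1 G2) : Prop :=
  (forall e : edge G2, exists e' : edge G1, hom_edge phi e' = e) /\
  (forall u v v' : G1, adj u v -> adj u v' -> phi v = phi v').

(* A graph on one vertex carries exactly one edge, the loop: the last field
   says that the graph at level 0 is ({0}, {(0, 0)}). *)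
Record cover_seq := CoverSeq {
  level :> nat -> graph;
  bond : forall n, graph_hom (level n.+1) (level n);
  bondP : forall n, is_cover (bond n);
  level0 : #|level 0| = 1%N }.

(* phi_{k + n, n} = phi_n \o ... \o phi_{k + n - 1} *)
Fixpoint bonds (S : cover_seq) (k n : nat) : graph_hom (S (k + n)%N) (S n) :=
  match k with
  | 0 => hom_id (S n)
  | k'.+1 => hom_comp (bonds S k' n) (bond S (k' + n)%N)
  end.

Section inverse_limit.
Variable S : cover_seq.

Definition threads : set (prod_topology (fun n => discrete_topology (S n))) :=
  [set x | forall n, x n = bond S n (x n.+1)].

Definition invlim : Type := set_type threads.

HB.instance Definition _ := Topological.copy invlim (set_type threads).

Definition entry (n : nat) (x : invlim) : S n := val x n.

Lemma entryE n (x : invlim) : entry n x = bond S n (entry n.+1 x).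
Proof. by case: x => x /= xP; have := set_mem xP; exact. Qed.

Lemma invlim_eq (x y : invlim) : (forall n, entry n x = entry n y) -> x = y.
Proof. by move=> xy; apply/val_inj/functional_extensionality_dep. Qed.

Definition mk_invlim (x : forall n, S n)
    (xP : forall n, x n = bond S n (x n.+1)) : invlim :=
  exist _ (x : prod_topology (fun n => discrete_topology (S n)))
    (@mem_set _ threads x xP).

Lemma bond_surj n (v : S n) : exists w, bond S n w == v.
Proof.
have [w vw] := adj_out v.
have [e eE] := (bondP S n).1 (exist _ (v, w) vw).
by exists (source e); apply/eqP; have /(congr1 (@source _)) := eE.
Qed.

Lemma level0_ne : exists v : S 0, true.
Proof. by have /fintype1[v _] := level0 S; exists v. Qed.

Fixpoint base_thread (n : nat) : S n :=
  match n with
  | 0 => xchoose level0_ne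
  | m.+1 => xchoose (bond_surj (base_thread m))
  end.

Lemma base_threadP n : base_thread n = bond S n (base_thread n.+1).
Proof. by rewrite /= (eqP (xchooseP (bond_surj (base_thread n)))). Qed.

HB.instance Definition _ := isPointed.Build invlim (mk_invlim base_threadP).

(* (f x)_n is the image under phi_n of an arbitrary out-neighbour of x_{n+1};
   because phi_n is a cover it does not depend on the neighbour chosen. *)
Definition next_entry (x : invlim) (n : nat) : S n :=
  bond S n (xchoose (adj_out (entry n.+1 x))).

Lemma next_entryE (x : invlim) n w :
  adj (entry n.+1 x) w -> bond S n w = next_entry x n.
Proof. by move=> xw; exact: (bondP S n).2 xw (xchooseP (adj_out _)). Qed.

Lemma next_entryP (x : invlim) n :
  next_entry x n = bond S n (next_entry x n.+1).
Proof.
apply/esym/next_entryE; rewrite entryE; apply: hom_adj.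
exact: xchooseP (adj_out _).
Qed.

Definition limit_map (x : invlim) : invlim := mk_invlim (next_entryP x).

Lemma limit_map_graph (x y : invlim) :
  y = limit_map x <-> forall n, adj (entry n x) (entry n y).
Proof.
split=> [-> n|xy].
  by rewrite (entryE n x); apply: hom_adj; exact: xchooseP (adj_out _).
by apply: invlim_eq => n; rewrite (entryE n y); exact: next_entryE.
Qed.

Definition cyl (n : nat) (v : S n) : set invlim := [set x | entry n x = v].

Definition cyl_edge (n : nat) (e : edge (S n)) : set invlim :=
  cyl (source e) `&` limit_map @^-1` cyl (target e).

Definition borel_invlim := g_sigma_algebraType (@open invlim).

HB.instance Definition _ := Measurable.on borel_invlim.

End inverse_limit.

Section measures.
Variables (R : realType) (S : cover_seq).

Definition finmeas : Type := {finite_measure set (borel_invlim S) -> \bar R}.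

HB.instance Definition _ := gen_eqMixin finmeas.
HB.instance Definition _ := gen_choiceMixin finmeas.

(* Weak topology: the coarsest one making mu |-> \int g dmu continuous for every
   continuous g; invlim S is compact, so every such g is bounded. *)
Definition integrals (mu : finmeas) :
    {ptws {g : invlim S -> R | continuous g} -> R} :=
  fun g => (\int[mu]_x (sval g x))%R.

HB.instance Definition _ := Topological.copy finmeas (initial_topology integrals).

(* A library measure is a function on all sets, constrained only on measurable
   ones. Requiring the value 0 elsewhere selects one representative for each
   Borel measure, so that equality of representatives is equality of measures. *)
Definition invariant_measures : set finmeas :=
  [set mu | (forall A : set (borel_invlim S), ~ measurable A -> mu A = 0%E) /\
            (forall A : set (borel_invlim S),
               measurable A -> mu (@limit_map S @^-1` A) = mu A)].

Definition invariant_probabilities : set finmeas :=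
  [set mu | invariant_measures mu /\ mu setT = 1%E].

Section combination.
Variables (a b : {nonneg R}) (mu nu : finmeas).

Definition comb_fun : set (borel_invlim S) -> \bar R :=
  measure_add (mscale a mu) (mscale b nu).

HB.instance Definition _ := Measure.on comb_fun.

Let comb_fin : fin_num_fun comb_fun.
Proof.
move=> A mA; rewrite /comb_fun measure_addE /mscale.
by rewrite fin_numD !fin_numM// fin_num_measure.
Qed.

HB.instance Definition _ :=
  @Measure_isFinite.Build _ (borel_invlim S) R comb_fun comb_fin.

Definition comb : finmeas := comb_fun.

Lemma combE (A : set (borel_invlim S)) :
  comb A = (a%:num%:E * mu A + b%:num%:E * nu A)%E.
Proof. exact: measure_addE. Qed.

Lemma comb_invariant :
  invariant_measures mu -> invariant_measures nu -> invariant_measures comb.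
Proof.
move=> [mu0 muI] [nu0 nuI]; split=> A mA; rewrite !combE.
  by rewrite mu0// nu0// !mule0 adde0.
by rewrite muI// nuI.
Qed.

Lemma comb_probability : a%:num + b%:num = 1 ->
  invariant_probabilities mu -> invariant_probabilities nu ->
  invariant_probabilities comb.
Proof.
move=> ab1 [muI mu1] [nuI nu1]; split; first exact: comb_invariant.
by rewrite combE mu1 nu1 !mule1 -EFinD ab1.
Qed.

End combination.
End measures.

Section chains.
Variable R : realType.

Definition flows (G : graph) : set {ptws edge G -> R} :=
  [set a | (forall e, 0 <= a e) /\
           forall v : G, \sum_(e | source e == v) a e =
                         \sum_(e | target e == v) a e].

Definition unit_flows (G : graph) : set {ptws edge G -> R} :=
  [set a | flows a /\ \sum_e a e = 1].

(* phi_* (sum_e a(e) e) = sum_e a(e) phi(e) *)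
Definition push (G1 G2 : graph) (phi : graph_hom G1 G2) (a : {ptws edge G1 -> R}) :
    {ptws edge G2 -> R} :=
  fun e => \sum_(e' | hom_edge phi e' == e) a e'.

Definition chain_seq (S : cover_seq) : topologicalType :=
  prod_topology (fun n => {ptws edge (S n) -> R}).

(* The pairs m > n are written m = k.+1 + n. *)
Definition compatible (S : cover_seq) : set (chain_seq S) :=
  [set x | forall k n, push (bonds S k.+1 n) (x (k.+1 + n)%N) = x n].

Definition limit_flows (S : cover_seq) : set (chain_seq S) :=
  [set x | (forall n, flows (x n)) /\ compatible x].

Definition limit_unit_flows (S : cover_seq) : set (chain_seq S) :=
  [set x | (forall n, unit_flows (x n)) /\ compatible x].

Definition edge_weights (S : cover_seq) (mu : finmeas R S) : chain_seq S :=
  fun n (e : edge (S n)) => fine (mu (cyl_edge e)).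

Definition chain_comb (S : cover_seq) (a b : {nonneg R}) (x y : chain_seq S) :
    chain_seq S :=
  fun n (e : edge (S n)) => a%:num * x n e + b%:num * y n e.

End chains.

Definition homeomorphic_via (T U : topologicalType) (A : set T) (B : set U)
    (p : T -> U) : Prop :=
  {within A, continuous p} /\
  exists q : U -> T,
    [/\ set_fun B A q, {in A, cancel p q}, {in B, cancel q p} &
        {within B, continuous q}].

(* Main.v *)
Require Import Defs.
From HB Require Import structures.
From mathcomp Require Import all_boot all_order all_algebra.
From mathcomp Require Import all_classical all_reals all_analysis.
From mathcomp Require Import lra.

Set Implicit Arguments.
Unset Strict Implicit.
Unset Printing Implicit Defensive.

Import Order.TTheory GRing.Theory Num.Theory.
Import numFieldNormedType.Exports.
Local Open Scope classical_set_scope.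
Local Open Scope ring_scope.

(** The space is cut, at each level [n], into the finitely many clopen cells
    U(e), one for each edge [e] of the [n]-th graph. Everything about an
    invariant measure can be read off the masses of these cells: the map
    [edge_at n], which sends a point to the edge it traverses at level [n], has
    the cells as its fibres, and [mu |-> edge_weights mu] lists the masses of
    the fibres. Each [edge_at n] is [edge_at n.+1] followed by the edge map of
    the cover, so additivity of the measure over cells is exactly compatibility
    of the weights, while invariance of the measure, tested on the cell of a
    vertex and on its preimage, is exactly the flow condition
    ([edge_weights_limit_flows]).

    Injectivity: the cells form, with their finite unions, an algebra that
    generates the Borel sets ([borel_cylinder_sets]), and two finite measures
    that agree on a generating pi-system agree ([finmeas_unique]).

    Surjectivity: a compatible sequence of weights defines an additive set
    function on this algebra. Compactness of the space, in the form of a Koenig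
    argument on cylinders ([cyl_uniform]), turns every countable disjoint union
    that stays inside the algebra into a finite one, so the set function is
    sigma-additive and Caratheodory extension applies ([finmeas_of_chain]).
    Invariance of the extension is checked on vertex cylinders, where it is the
    flow condition ([edge_weights_surj]).

    Topology: the mass of a cell is the integral of its indicator, a continuous
    function, so the map is continuous. In the other direction, by the same
    compactness argument a continuous function is uniformly close to one that
    is constant on the cells of some level, so its integral differs from a
    fixed linear combination of the weights by a small multiple of the total
    mass ([Rintegral_approx]). The total mass is itself the sum of the weights
    at level 0, hence is locally bounded, and the integral depends continuously
    on the weights ([continuous_edge_weights_inverse]). *)

(** * Threads through edges and a compactness principle *)

Section threads.
Variable S : cover_seq.
Implicit Types (x y : invlim S) (n k : nat).

Lemma edge_at_subproof n x : adj (entry n x) (entry n (limit_map x)).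
Proof. exact: (limit_map_graph x _).1. Qed.

Definition edge_at n x : edge (S n) :=
  exist (fun e : S n * S n => adj e.1 e.2)
    (entry n x, entry n (limit_map x)) (edge_at_subproof n x).

Lemma cyl_edgeE n (e : edge (S n)) : cyl_edge e = edge_at n @^-1` [set e].
Proof.
apply/seteqP; split=> x /= => [[xs xt]|<-//].
by apply: val_inj; move: xs xt; case: e => -[u v] uv /= -> ->.
Qed.

Lemma edge_at_bond n x : edge_at n x = hom_edge (bond S n) (edge_at n.+1 x).
Proof. by apply: val_inj; rewrite /= -!entryE. Qed.

Lemma edge_at_bonds k n x :
  edge_at n x = hom_edge (bonds S k n) (edge_at (k + n)%N x).
Proof.
elim: k => [|k IHk]; first exact: val_inj.
by rewrite IHk edge_at_bond; apply: val_inj.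
Qed.

(** The vertex at level [n.+1] already decides the edge at level [n]: by the
    cover condition all its out-neighbours have the same image. *)
Lemma edge_at_next n x y :
  entry n.+1 x = entry n.+1 y -> edge_at n x = edge_at n y.
Proof.
move=> xy; apply: val_inj; rewrite /= (entryE n x) (entryE n y) xy; congr pair.
by rewrite /entry /= /next_entry xy.
Qed.

(** Going down from [v] is forced, so the levels below [n] are obtained by
    projection; the values above [n] are arbitrary and are replaced in
    [entry_surj]. *)
Lemma path_to n (v : S n) : exists z : forall i, S i,
  z n = v /\ forall i, (i < n)%N -> z i = bond S i (z i.+1).
Proof.
elim: n v => [|n IHn] v.
  exists (dfwith (base_thread S) 0%N v); split; last by [].
  by rewrite dfwithin.
have [z [zn zP]] := IHn (bond S n v).
exists (dfwith z n.+1 v); split=> [|i]; first by rewrite dfwithin.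
rewrite ltnS leq_eqVlt => /orP[/eqP -> {i}|lt_in].
  by rewrite dfwithin dfwithout ?neq_ltn ?ltnSn ?orbT.
have [ni ni1] : n.+1 != i /\ n.+1 != i.+1 by rewrite !gtn_eqF// ltnS ltnW.
by rewrite (dfwithout z v ni) (dfwithout z v ni1) zP.
Qed.

Lemma entry_surj n (v : S n) : exists x, entry n x = v.
Proof.
have [z [zn zP]] := path_to v.
(* The case distinction follows [z] for as long as [z] is a thread, and lifts
   arbitrarily from then on. *)
pose y := fix y m : S m := match m with
  | 0 => z 0
  | m'.+1 => if bond S m' (z m'.+1) == y m' then z m'.+1
             else xchoose (bond_surj (y m'))
  end.
have yP m : y m = bond S m (y m.+1).
  by rewrite /=; case: ifP => [/eqP//|_]; rewrite (eqP (xchooseP (bond_surj _))).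
have yz m : (m <= n)%N -> y m = z m.
  elim: m => // m IHm lt_mn; rewrite /= IHm 1?ltnW// -zP// eqxx//.
by exists (mk_invlim yP); rewrite /entry /= yz.
Qed.

(** Lifting [e] to an edge [e'] of the next level, any thread through the source
    of [e'] works: its image has, by the cover condition, the target of [e] as
    its entry. *)
Lemma edge_at_surj n (e : edge (S n)) : exists x, edge_at n x = e.
Proof.
have [e' <-] := (bondP S n).1 e.
have [x xE] := entry_surj (source e').
exists x; apply: val_inj; rewrite /= (entryE n x) xE; congr pair.
by apply/esym/next_entryE; rewrite xE; case: (e').
Qed.

Lemma entry_le n m x y : (n <= m)%N ->
  entry m x = entry m y -> entry n x = entry n y.
Proof.
have E k z : entry n z = bonds S k n (entry (k + n)%N z).
  by elim: k => // k ->; rewrite entryE.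
by move=> /subnK <- xy; rewrite !(E (m - n)%N) xy.
Qed.

(** Compactness of the inverse limit, in the form in which it is used: a property
    inherited by subsets that holds on some cylinder around each point holds on
    all cylinders of one level. If it failed, some vertex of level 0 would have
    bad cylinders arbitrarily deep above it; as each vertex has finitely many
    lifts, badness passes to one of them, and the thread of bad vertices so
    obtained contradicts the hypothesis at that point. *)
Lemma cyl_uniform (Q : set (set (invlim S))) :
  (forall A B, A `<=` B -> Q B -> Q A) ->
  (forall x, exists n, Q (cyl (entry n x))) ->
  exists N, forall x, Q (cyl (entry N x)).
Proof.
move=> Qsub Qcov; apply: contrapT => noN.
pose bad n (v : S n) :=
  forall k, exists2 x, entry n x = v & ~ Q (cyl (entry (n + k) x)).
have Qle n m x : (n <= m)%N -> Q (cyl (entry n x)) -> Q (cyl (entry m x)).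
  by move=> nm; apply: Qsub => y /= /(entry_le nm).
have lift_bad n (v : S n) : bad n v -> exists2 w, bond S n w = v & bad n.+1 w.
  move=> badv; apply: contrapT => noW.
  have good w : exists k, bond S n w = v ->
      forall x, entry n.+1 x = w -> Q (cyl (entry (n.+1 + k) x)).
    have [wv|wv] := pselect (bond S n w = v); last by exists 0%N.
    apply: contrapT => badw; apply: noW; exists w => // k.
    apply: contrapT => Nk; apply: badw; exists k => _ x xw.
    by apply: contrapT => ?; apply: Nk; exists x.
  have [k kP] := choice good.
  have [x xv] := badv (1 + \max_w k w)%N; apply.
  apply: (@Qle (n.+1 + k (entry n.+1 x))%N).
    by rewrite addnA addn1 leq_add2l; exact: leq_bigmax.
  by apply: kP => //; rewrite -entryE.
have [v0 all_v0] : exists v : S 0, forall w, w = v.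
  by have /fintype1[v vP] := level0 S; exists v.
have bad0 : bad 0%N v0.
  move=> k; apply: contrapT => Nk; apply: noN; exists k => x.
  by apply: contrapT => ?; apply: Nk; exists x.
have [h hP] : {h : forall n, S n -> S n.+1 |
    forall n v, bad n v -> bond S n (h n v) = v /\ bad n.+1 (h n v)}.
  have H n : forall v : S n, exists w : S n.+1,
      bad n v -> bond S n w = v /\ bad n.+1 w.
    move=> v.
    have [/lift_bad[w wv badw]|bv] := pselect (bad n v); first by exists w.
    by have [w _] := bond_surj v; exists w.
  by exists (fun n => projT1 (choice (H n))) => n; exact: projT2 (choice (H n)).
pose t := fix t n : S n := if n is m.+1 then h m (t m) else v0.
have badt n : bad n (t n) by elim: n => [|n IHn] //=; have [] := hP n _ IHn.
have tP n : t n = bond S n (t n.+1) by have [] := hP n _ (badt n).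
have [n Qn] := Qcov (mk_invlim tP).
have [x xt] := badt n 0%N; apply.
by rewrite addn0 xt.
Qed.

End threads.

(** * The topology of the inverse limit *)

(** The topologies of the inverse limit and of the space of measures are both
    initial, for the inclusion of the threads in the product and for [integrals],
    neither of which is surjective; hence this form next to [cvg_image]. *)
Lemma initial_cvgP (T : choiceType) (U : topologicalType) (f : T -> U)
    (F : set_system T) {FF : Filter F} (t : T) :
  F --> (t : initial_topology f) <-> f @ F --> f t.
Proof.
split=> [Ft|Fft].
  exact: (cvg_comp _ _ Ft (@initial_continuous _ _ f t)).
move=> A /=; rewrite nbhsE => -[_ [[B oB <-] Bt] BA].
by rewrite nbhs_filterE; apply: filterS BA _; apply: Fft; exact: open_nbhs_nbhs.
Qed.

Lemma prod_cvgP (I : Type) (K : I -> topologicalType)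
    (F : set_system (prod_topology K)) {FF : Filter F} (f : prod_topology K) :
  F --> f <-> forall i, (fun g : prod_topology K => g i) @ F --> f i.
Proof.
split=> [/cvg_sup Ff i|Ff].
  exact/(initial_cvgP (fun g : prod_topology K => g i))/Ff.
by apply/cvg_sup => i; apply/(initial_cvgP (fun g : prod_topology K => g i)).
Qed.

Section invlim_topology.
Variable S : cover_seq.
Implicit Types (x y : invlim S) (n : nat).

Lemma cyl_nbhs n x : nbhs x (cyl (entry n x)).
Proof.
have /(initial_cvgP (val : invlim S -> _)) :
    nbhs x --> (x : set_type (@threads S)) by exact: cvg_id.
move=> /prod_cvgP/(_ n)/= h.
by apply: (h [set entry n x]); exact: discrete_set1.
Qed.

(** The filter generated by the cylinders around [x] converges to [x] because
    each of its coordinates is eventually constant. *)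
Lemma nbhs_cyl x (U : set (invlim S)) :
  nbhs x U -> exists n, cyl (entry n x) `<=` U.
Proof.
pose F := filter_from setT (fun n => cyl (entry n x)).
have FF : Filter F.
  apply: filter_from_filter; first by exists 0%N.
  move=> i j _ _; exists (maxn i j) => // y /= yx; split.
    by apply: entry_le yx; exact: leq_maxl.
  by apply: entry_le yx; exact: leq_maxr.
suff Fx : F --> x by move=> /Fx[n _ nU]; exists n.
apply/(initial_cvgP (val : invlim S -> _))/prod_cvgP => n A.
by move=> /nbhs_singleton Ax; exists n => // y /= yx; rewrite /= -/(entry n y) yx.
Qed.

Lemma open_edge_at n (P : set (edge (S n))) : open (edge_at n @^-1` P).
Proof.
rewrite openE => x Px; apply: filterS (@cyl_nbhs n.+1 x) => y yx.
by rewrite /preimage /= (edge_at_next yx).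
Qed.

Lemma limit_map_continuous : continuous (@limit_map S).
Proof.
move=> x U /nbhs_cyl[n nU]; apply: filterS (@cyl_nbhs n.+1 x) => y yx.
by apply: nU; have /(congr1 (@target _)) := edge_at_next yx.
Qed.

(** There being finitely many edges at each level, this exhibits every open set
    as a countable union of cells, which is why the cylinder sets generate the
    Borel sets. *)
Lemma open_bigcup_edge_at (U : set (invlim S)) : open U ->
  U = \bigcup_n (edge_at n @^-1` [set e | edge_at n @^-1` [set e] `<=` U]).
Proof.
move=> oU; apply/seteqP; split=> [x Ux|x [n _]]; last exact.
have [n nU] := nbhs_cyl (open_nbhs_nbhs (conj oU Ux)).
exists n => // y yx; apply: nU.
by have /(congr1 (@source _)) := yx.
Qed.

End invlim_topology.

(** * The algebra of cylinder sets *)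

Section cylinder_algebra.
Variable S : cover_seq.

Definition cylinder_sets : set (set (invlim S)) :=
  [set A | exists n (P : set (edge (S n))), A = edge_at n @^-1` P].

Lemma edge_at_preimage_bonds k n (P : set (edge (S n))) :
  edge_at n @^-1` P = edge_at (k + n)%N @^-1` (hom_edge (bonds S k n) @^-1` P).
Proof.
by apply/funext => x; rewrite /preimage /= (edge_at_bonds k n).
Qed.

Lemma edge_at_preimage_le n m (P : set (edge (S n))) : (n <= m)%N ->
  exists Q : set (edge (S m)), edge_at n @^-1` P = edge_at m @^-1` Q.
Proof. by move=> /subnK <-; rewrite (edge_at_preimage_bonds (m - n)); eexists. Qed.

Lemma cylinder_sets_common A B : cylinder_sets A -> cylinder_sets B ->
  exists n (P Q : set (edge (S n))),
    A = edge_at n @^-1` P /\ B = edge_at n @^-1` Q.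
Proof.
move=> [n [P ->]] [m [Q ->]]; exists (maxn n m).
have [P' ->] := edge_at_preimage_le P (leq_maxl n m).
have [Q' ->] := edge_at_preimage_le Q (leq_maxr n m).
by exists P', Q'.
Qed.

Lemma cylinder_sets0 : cylinder_sets set0.
Proof. by exists 0%N, set0; rewrite preimage_set0. Qed.

Lemma cylinder_setsC : setC_closed cylinder_sets.
Proof. by move=> _ [n [P ->]]; exists n, (~` P); rewrite preimage_setC. Qed.

Lemma cylinder_setsU : setU_closed cylinder_sets.
Proof.
move=> A B cA cB; have [n [P [Q [-> ->]]]] := cylinder_sets_common cA cB.
by exists n, (P `|` Q); rewrite preimage_setU.
Qed.

Lemma cylinder_setsI : setI_closed cylinder_sets.
Proof.
move=> A B cA cB; have [n [P [Q [-> ->]]]] := cylinder_sets_common cA cB.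
by exists n, (P `&` Q); rewrite preimage_setI.
Qed.

Lemma borel_cylinder_sets :
  (measurable : set (set (borel_invlim S))) = <<s cylinder_sets >>.
Proof.
apply/seteqP; split; last first.
  apply: sub_sigma_algebra2 => _ [n [P ->]]; exact: open_edge_at.
apply: smallest_sub; first exact: smallest_sigma_algebra.
move=> U /open_bigcup_edge_at ->.
apply: sigma_algebra_bigcup => n; apply: sub_sigma_algebra.
by eexists; eexists.
Qed.

Lemma measurable_edge_at n (P : set (edge (S n))) :
  measurable (edge_at n @^-1` P : set (borel_invlim S)).
Proof. by apply: sub_sigma_algebra; exact: open_edge_at. Qed.

(** A copy of the inverse limit, so that the algebra of cylinder sets does not
    compete with the Borel sets for the role of measurable sets. *)
Definition cylinder_algebra : Type := invlim S.

HB.instance Definition _ := Pointed.on cylinder_algebra.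
HB.instance Definition _ := @isAlgebraOfSets.Build default_measure_display
  cylinder_algebra cylinder_sets cylinder_sets0 cylinder_setsU cylinder_setsC.

End cylinder_algebra.

(** * From compatible weights to a measure *)

(** The unbundled form of the passage from a measure to a finite measure, usable
    for a measure built inside a proof. *)
Lemma finite_measure_of (d : measure_display) (T : measurableType d)
    (R : realType) (M : {measure set T -> \bar R}) : fin_num_fun M ->
  exists N : {finite_measure set T -> \bar R}, N = M :> (set T -> \bar R).
Proof.
move=> Mfin.
have Msigma : sigma_finite setT M.
  by apply: fin_num_fun_sigma_finite; rewrite ?measure0.
have Msfin := sfinite_measure_sigma_finite Msigma.
pose N := HB.pack_for (FiniteMeasure.type T R) (Measure.sort M)
  (isFinite.Build _ _ _ _ Mfin) (isSFinite.Build _ _ _ _ Msfin)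
  (isSigmaFinite.Build _ _ _ _ Msigma).
by exists N.
Qed.

Section extension.
Variables (R : realType) (S : cover_seq) (x : chain_seq R S).
Arguments x : clear implicits.
Hypotheses (x_ge0 : forall n (e : edge (S n)), 0 <= x n e) (xC : compatible x).

Definition edge_sum n (P : set (edge (S n))) : R := \sum_(e | `[< P e >]) x n e.

(** The level at which a cylinder set is described is not unique; some level is
    chosen, and [cylinder_massE] shows that the choice is immaterial. Sets that
    are not cylinder sets receive a nonnegative junk value. *)
Definition cylinder_mass (A : set (invlim S)) : R :=
  let n := xget 0%N [set n | exists P : set (edge (S n)), A = edge_at n @^-1` P]
  in edge_sum (@edge_at S n @` A).

Lemma edge_sum_bonds k n (P : set (edge (S n))) :
  edge_sum (hom_edge (bonds S k n) @^-1` P) = edge_sum P.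
Proof.
case: k => [|k].
  apply: eq_bigl => e; congr asbool; rewrite /preimage /=; congr P.
  by apply: val_inj; case: e => -[].
rewrite /edge_sum.
rewrite (partition_big (hom_edge (bonds S k.+1 n)) (fun e => `[< P e >]))//=.
apply: eq_bigr => e /asboolP Pe; rewrite -(xC k n); apply: eq_bigl => e' /=.
by apply: andb_idl => /eqP e'e; apply/asboolP; rewrite /preimage /= e'e.
Qed.

(** Raising the lower of the two levels makes both sides sums over the same edges;
    the two sets of edges are then equal because every edge is traversed by
    some thread. *)
Lemma edge_sum_eq n m (P : set (edge (S n))) (Q : set (edge (S m))) :
  edge_at n @^-1` P = edge_at m @^-1` Q -> edge_sum P = edge_sum Q.
Proof.
wlog le_nm : n m P Q / (n <= m)%N.
  by have [nm|/ltnW mn] := leqP n m => h e; [exact: h|apply/esym/h].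
rewrite -(subnK le_nm) in Q *; rewrite (edge_at_preimage_bonds (m - n)) => PQ.
rewrite -(edge_sum_bonds (m - n)); congr edge_sum; apply/funext => e.
have [y <-] := edge_at_surj e.
exact: (congr1 (fun A : set (invlim S) => A y) PQ).
Qed.

Lemma cylinder_massE n (P : set (edge (S n))) :
  cylinder_mass (edge_at n @^-1` P) = edge_sum P.
Proof.
rewrite /cylinder_mass; case: xgetP => [m _ [Q PQ]|/(_ n)]; last first.
  by move=> /=[]; exists P.
apply/esym/edge_sum_eq; rewrite {1}PQ; congr (_ @^-1` _).
rewrite PQ image_preimage//; apply/seteqP; split=> // e _.
by have [y <-] := edge_at_surj e; exists y.
Qed.

Lemma cylinder_mass_ge0 A : 0 <= cylinder_mass A.
Proof. exact: sumr_ge0. Qed.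

Lemma cylinder_mass0 : cylinder_mass set0 = 0.
Proof.
rewrite -(preimage_set0 (@edge_at S 0)) cylinder_massE /edge_sum big_pred0// => e.
exact/asboolP.
Qed.

Lemma cylinder_massU A B : cylinder_sets A -> cylinder_sets B ->
  A `&` B = set0 -> cylinder_mass (A `|` B) = cylinder_mass A + cylinder_mass B.
Proof.
move=> cA cB; have [n [P [Q [-> ->]]]] := cylinder_sets_common cA cB => PQ0.
rewrite -preimage_setU !cylinder_massE /edge_sum (bigID (fun e => `[< P e >])) /=.
congr (_ + _); apply: eq_bigl => e.
  by apply/andP/asboolP => [[_ /asboolP//]|Pe]; split; apply/asboolP => //; left.
apply/andP/asboolP => [[/asboolP[//Pe /asboolP//|//]]|Qe].
split; first by apply/asboolP; right.
apply/asboolP => Pe; have [y ye] := edge_at_surj e.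
by have : set0 y by rewrite -PQ0; split; rewrite /preimage /= ye.
Qed.

Lemma cylinder_mass_bigsetU (F : (set (invlim S))^nat) k :
  (forall i, cylinder_sets (F i)) -> trivIset setT F ->
  cylinder_sets (\big[setU/set0]_(i < k) F i) /\
  cylinder_mass (\big[setU/set0]_(i < k) F i) = \sum_(i < k) cylinder_mass (F i).
Proof.
move=> cF tF; elim: k => [|k [cU IHk]].
  by rewrite !big_ord0; split; [exact: cylinder_sets0|exact: cylinder_mass0].
rewrite !big_ord_recr /= cylinder_massU// ?IHk.
  by split=> //; exact: cylinder_setsU.
rewrite big_distrl /= big1// => i _; move/trivIsetP : tF; apply => //.
by rewrite neq_ltn ltn_ord.
Qed.

(** This is [cyl_uniform] for the property of a set that finitely many [F i] cover
    its part inside the union. Points outside the union satisfy it because the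
    union, a cylinder set, misses a whole cylinder around them. *)
Lemma cylinder_cover_finite (F : (set (invlim S))^nat) :
  (forall i, cylinder_sets (F i)) -> cylinder_sets (\bigcup_i F i) ->
  exists k, \bigcup_i F i `<=` \big[setU/set0]_(i < k) F i.
Proof.
move=> cF [m [P UP]].
pose Q A := exists k, A `&` \bigcup_i F i `<=` \big[setU/set0]_(i < k) F i.
have le_bigU i j y : (i <= j)%N -> (\big[setU/set0]_(l < i) F l) y ->
    (\big[setU/set0]_(l < j) F l) y.
  by rewrite -!bigcup_mkord => ij [l /= li Fl]; exists l => //=; exact: leq_trans ij.
have [|y|N NQ] := @cyl_uniform S Q.
- by move=> A B AB [k Bk]; exists k; apply: subset_trans Bk; exact: setSI.
- have [[i _ Fi]|Uy] := pselect ((\bigcup_i F i) y).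
    have [n [P' FP']] := cF i; exists n.+1, i.+1 => z [/= zy _].
    rewrite big_ord_recr; right; move: Fi.
    by rewrite FP' /preimage /= (edge_at_next zy).
  exists m.+1, 0%N => z [/= zy]; rewrite big_ord0.
  by move: Uy; rewrite UP /preimage /= (edge_at_next zy).
have /choice[k kP] : forall v : S N, exists k,
    cyl v `&` \bigcup_i F i `<=` \big[setU/set0]_(i < k) F i.
  by move=> v; have [y <-] := entry_surj v; exact: NQ.
exists (\max_v k v) => y Uy; apply: le_bigU (kP (entry N y) y _) => //.
exact: leq_bigmax.
Qed.

(** By [cylinder_cover_finite] the members of a disjoint family are empty from
    some rank on, so the partial sums are eventually constant. *)
Lemma cylinder_mass_sigma_additive :
  semi_sigma_additive
    ((fun A => (cylinder_mass A)%:E) : set (cylinder_algebra S) -> \bar R).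
Proof.
move=> F cF tF cU.
have [k Uk] := cylinder_cover_finite cF cU.
apply: cvg_near_cst; exists k => // n /= kn.
rewrite sumEFin; congr EFin; rewrite big_mkord.
have [_ <-] := cylinder_mass_bigsetU n cF tF; congr cylinder_mass.
rewrite -bigcup_mkord; apply/seteqP; split=> [y [i _ Fi]|y /Uk]; first by exists i.
by rewrite -bigcup_mkord => -[l /= lk Fl]; exists l => //=; exact: leq_trans kn.
Qed.

(** Caratheodory extension of [cylinder_mass], set to 0 off the Borel sets so that
    it is the selected representative of its measure. *)
Lemma finmeas_of_chain : exists mu : finmeas R S,
  (forall A : set (borel_invlim S), ~ measurable A -> mu A = 0%E) /\
  (forall n (P : set (edge (S n))), mu (edge_at n @^-1` P) = (edge_sum P)%:E).
Proof.
pose m0 : set (cylinder_algebra S) -> \bar R := fun A => (cylinder_mass A)%:E.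
have m00 : m0 set0 = 0%E by rewrite /m0 cylinder_mass0.
have m0_ge0 A : (0 <= m0 A)%E by rewrite lee_fin cylinder_mass_ge0.
pose M0 : {measure set (cylinder_algebra S) -> \bar R} :=
  HB.pack m0 (isMeasure.Build _ _ _ m0 m00 m0_ge0 cylinder_mass_sigma_additive).
pose ext := measure_extension M0.
pose m : set (borel_invlim S) -> \bar R :=
  fun A => if `[< measurable A >] then ext A else 0%E.
have borelE (A : set (borel_invlim S)) : measurable A = <<s @cylinder_sets S >> A.
  by rewrite borel_cylinder_sets.
have mE A : measurable A -> m A = ext A by move=> mA; rewrite /m asboolT.
have m_0 : m set0 = 0%E by rewrite mE// /ext measure0.
have m_ge0 A : (0 <= m A)%E by rewrite /m; case: ifP.
have m_sigma : semi_sigma_additive m.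
  move=> F mF tF mU; rewrite mE//.
  rewrite (_ : (fun n => _) = fun n => \sum_(0 <= i < n) ext (F i))%E.
    by apply: measure_semi_sigma_additive => // [i|]; rewrite -[measurable _]borelE.
  by apply/funext => n; apply: eq_bigr => i _; rewrite mE.
have m_edge n (P : set (edge (S n))) : m (edge_at n @^-1` P) = (edge_sum P)%:E.
  rewrite mE; last exact: measurable_edge_at.
  rewrite /ext /measure_extension measurable_mu_extE ?cylinder_massE//=.
    by rewrite /m0 cylinder_massE.
  by exists n, P.
pose M : {measure set (borel_invlim S) -> \bar R} :=
  HB.pack m (isMeasure.Build _ _ _ m m_0 m_ge0 m_sigma).
have m_fin : fin_num_fun M.
  have mT : (M setT < +oo)%E.
    by rewrite -(preimage_setT (@edge_at S 0)) /= m_edge ltry.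
  move=> A mA; rewrite ge0_fin_numE//; apply: le_lt_trans mT.
  by apply: le_measure; rewrite ?inE.
have [mu muE] := finite_measure_of m_fin.
exists mu; rewrite muE; split=> [A mA|]; last exact: m_edge.
by rewrite /= /m asboolF.
Qed.

End extension.

(** * Invariant measures and limit flows *)

Section edge_weights_theory.
Variables (R : realType) (S : cover_seq).
Implicit Types (mu nu : finmeas R S) (n : nat).

(** The structure carried by a finite measure consists of proofs. *)
Lemma finmeas_eq mu nu : mu = nu :> (set _ -> \bar R) -> mu = nu.
Proof.
move: mu nu => [m [[a b] [c] [d] [e] [f]]] [m' [[+ +] [+] [+] [+] [+]]] /= mm'.
rewrite -{}mm' => a' b' c' d' e' f'; f_equal.
rewrite (Prop_irrelevance a' a) (Prop_irrelevance b' b) (Prop_irrelevance c' c).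
by rewrite (Prop_irrelevance d' d) (Prop_irrelevance e' e) (Prop_irrelevance f' f).
Qed.

Lemma finmeas_edge_sum mu n (P : set (edge (S n))) :
  mu (edge_at n @^-1` P) = (edge_sum (edge_weights mu) P)%:E.
Proof.
have -> : edge_at n @^-1` P = \bigcup_(e in P) edge_at n @^-1` [set e].
  by rewrite -preimage_bigcup bigcup_imset1 image_id.
rewrite measure_fin_bigcup//.
- rewrite (fsbigE [seq e <- index_enum (edge (S n)) | e \in P]); last 3 first.
  + by rewrite filter_uniq// index_enum_uniq.
  + by move=> e; rewrite /= mem_filter => /andP[/set_mem].
  + by move=> e Pe; rewrite mem_filter mem_index_enum andbT (mem_set Pe).
  rewrite big_filter_cond /edge_sum -sumEFin.
  apply: eq_big => [e|e _].
    by rewrite andbb; apply/idP/asboolP; rewrite in_setE.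
  rewrite /edge_weights cyl_edgeE fineK//.
  by apply: (fin_num_measure mu); exact: measurable_edge_at.
- exact: finite_finset.
- by move=> e f _ _ [y [/= <- <-]].
- by move=> e _; exact: measurable_edge_at.
Qed.

Lemma edge_sumT (x : chain_seq R S) n :
  edge_sum x [set: edge (S n)] = \sum_(e : edge (S n)) x n e.
Proof. by apply: eq_bigl => e; exact/asboolP. Qed.

Lemma edge_sum1 (x : chain_seq R S) n (e : edge (S n)) :
  edge_sum x [set e] = x n e.
Proof.
rewrite /edge_sum (big_pred1 e)// => f.
by apply/asboolP/eqP.
Qed.

Lemma finmeas_unique mu nu :
  (forall A : set (borel_invlim S), ~ measurable A -> mu A = 0%E) ->
  (forall A : set (borel_invlim S), ~ measurable A -> nu A = 0%E) ->
  edge_weights mu = edge_weights nu -> mu = nu.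
Proof.
move=> mu0 nu0 munu; apply/finmeas_eq/funext => A.
have [mA|nA] := pselect (measurable (A : set (borel_invlim S))); last first.
  by rewrite mu0// nu0.
have cT : cylinder_sets [set: invlim S] by exists 0%N, setT.
apply: (@measure_unique _ R (borel_invlim S) (@cylinder_sets S) (fun=> setT)
  _ _ _ _ mu nu _ _ A mA) => //.
- exact: borel_cylinder_sets.
- exact: cylinder_setsI.
- by apply/seteqP; split=> // y _; exists 0%N.
- by move=> _ [n [P ->]]; rewrite [LHS]finmeas_edge_sum [RHS]finmeas_edge_sum munu.
- by move=> _; rewrite -ge0_fin_numE//; exact: fin_num_measure.
Qed.

Lemma edge_weights_compatible mu : compatible (edge_weights mu).
Proof.
move=> k n; apply/funext => e; apply: EFin_inj.
rewrite -[in RHS]edge_sum1 -finmeas_edge_sum (edge_at_preimage_bonds k.+1).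
rewrite finmeas_edge_sum; congr EFin.
by apply: eq_bigl => e'; apply/eqP/asboolP.
Qed.

Lemma edge_weights_flows mu n :
  (forall A : set (borel_invlim S),
     measurable A -> mu (@limit_map S @^-1` A) = mu A) ->
  flows (@edge_weights R S mu n).
Proof.
move=> muI; split=> [e|v]; first exact: fine_ge0.
have -> : \sum_(e | source e == v) edge_weights mu e =
    edge_sum (edge_weights mu) (@source (S n) @^-1` [set v]).
  by apply: eq_bigl => e; apply/eqP/asboolP.
have -> : \sum_(e | target e == v) edge_weights mu e =
    edge_sum (edge_weights mu) (@target (S n) @^-1` [set v]).
  by apply: eq_bigl => e; apply/eqP/asboolP.
apply: EFin_inj; rewrite -!finmeas_edge_sum -[LHS]muI//.
exact: measurable_edge_at.
Qed.

Lemma measurable_limit_map :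
  measurable_fun setT (@limit_map S : borel_invlim S -> borel_invlim S).
Proof.
apply: (@measurability _ _ (borel_invlim S) (borel_invlim S) setT (@limit_map S)
  (@open (invlim S)) erefl).
move=> _ [U oU <-]; rewrite setTI; apply: sub_sigma_algebra.
by apply: open_comp => // y _; exact: limit_map_continuous.
Qed.

(** The flow condition, summed over the vertices in [V]. *)
Lemma edge_sum_flow (x : chain_seq R S) n (V : set (S n)) : flows (x n) ->
  edge_sum x (@source (S n) @^-1` V) = edge_sum x (@target (S n) @^-1` V).
Proof.
move=> [_ xn]; rewrite /edge_sum.
rewrite (partition_big (@source (S n)) (fun v => `[< V v >]))//=.
rewrite (partition_big (@target (S n)) (fun v => `[< V v >]))//=.
apply: eq_bigr => v Vv.
transitivity (\sum_(e | source e == v) x n e).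
  by apply: eq_bigl => e; apply: andb_idl => /eqP ->.
rewrite xn.
by apply: eq_bigl => e; apply/esym/andb_idl => /eqP ->.
Qed.

(** Under the dynamics the preimage of a vertex cylinder is described by one edge,
    that of an edge cell by two consecutive edges. One level up, an edge cell
    becomes a union of vertex cylinders, on which invariance is easily tested. *)
Lemma edge_at_preimage_entry n (P : set (edge (S n))) :
  exists V : set (S n.+1), edge_at n @^-1` P = @entry S n.+1 @^-1` V.
Proof.
exists (@entry S n.+1 @` (edge_at n @^-1` P)); apply/seteqP; split=> [y Py|y].
  by exists y.
by move=> [z Pz zy]; rewrite /preimage /= -(edge_at_next zy).
Qed.

(** The extension and its image under the dynamics agree on vertex cylinders: the
    first gives the outgoing and the second the incoming weight. *)
Lemma edge_weights_surj (x : chain_seq R S) : limit_flows x ->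
  exists2 mu, invariant_measures mu & edge_weights mu = x.
Proof.
move=> [xf xC].
have [|mu [mu0 muE]] := finmeas_of_chain _ xC; first by move=> n; exact: (xf n).1.
exists mu; last first.
  apply: functional_extensionality_dep => n; apply/funext => e.
  by apply: EFin_inj; rewrite -edge_sum1 -finmeas_edge_sum muE edge_sum1.
split=> // A mA.
have cT : cylinder_sets [set: invlim S] by exists 0%N, setT.
pose mf : {mfun borel_invlim S >-> borel_invlim S} :=
  HB.pack (@limit_map S : borel_invlim S -> borel_invlim S)
  (isMeasurableFun.Build _ _ _ _ _ measurable_limit_map).
apply: (@measure_unique _ R (borel_invlim S) (@cylinder_sets S) (fun=> setT)
  _ _ _ _ (pushforward mu mf) mu _ _ A mA) => //.
- exact: borel_cylinder_sets.
- exact: cylinder_setsI.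
- by apply/seteqP; split=> // y _; exists 0%N.
- move=> _ [n [P ->]] /=; rewrite /pushforward.
  have [V ->] := edge_at_preimage_entry P.
  have -> : @entry S n.+1 @^-1` V = edge_at n.+1 @^-1` (@source _ @^-1` V) by [].
  have -> : mf @^-1` (edge_at n.+1 @^-1` (@source _ @^-1` V)) =
      edge_at n.+1 @^-1` (@target _ @^-1` V) by [].
  by rewrite !muE edge_sum_flow.
- move=> _; have := fin_num_measure mu _ (@measurableT _ (borel_invlim S)).
  by rewrite ge0_fin_numE.
Qed.

Lemma total_mass mu n : mu setT = (\sum_(e : edge (S n)) edge_weights mu e)%:E.
Proof. by rewrite -edge_sumT -finmeas_edge_sum. Qed.

Lemma edge_weights_comb (a b : {nonneg R}) mu nu :
  edge_weights (comb a b mu nu) =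
  chain_comb a b (edge_weights mu) (edge_weights nu).
Proof.
apply: functional_extensionality_dep => n; apply/funext => e.
apply: EFin_inj; rewrite -edge_sum1 -finmeas_edge_sum combE.
by rewrite !finmeas_edge_sum !edge_sum1.
Qed.

End edge_weights_theory.

(** * Integrals of continuous functions *)

Section integration.
Variables (R : realType) (S : cover_seq).
Implicit Types (mu : finmeas R S) (g : invlim S -> R) (n : nat).

Lemma continuous_edge_at (T : topologicalType) n (h : edge (S n) -> T) :
  continuous (h \o edge_at n).
Proof.
move=> x U hU; apply: filterS (@cyl_nbhs S n.+1 x) => y yx.
by rewrite /= (edge_at_next yx); exact: nbhs_singleton hU.
Qed.

(** Uniform continuity: [cyl_uniform] applied to the oscillation of [g]. *)
Lemma continuous_uniform g (eps : R) : continuous g -> 0 < eps ->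
  exists n, forall x y, edge_at n x = edge_at n y -> `|g x - g y| <= eps.
Proof.
move=> cg eps0.
pose Q (A : set (invlim S)) := forall x y, A x -> A y -> `|g x - g y| <= eps.
have [A B AB QB x y /AB Bx /AB By||N NQ] := @cyl_uniform S Q; first exact: QB.
- move=> x; have e2 : 0 < eps / 2 by rewrite divr_gt0.
  have /nbhs_cyl[n nU] : nbhs x [set y | `|g x - g y| < eps / 2].
    by move/cvgrPdist_lt : (cg x) => /(_ _ e2).
  exists n => y z /nU yx /nU zx; rewrite (splitr eps) -(subrKA (g x)).
  rewrite (le_trans (ler_normD _ _))//.
  by rewrite lerD// ltW// distrC.
- exists N => x y /(congr1 (@source _)) xy.
  exact: (NQ x).
Qed.

Lemma measurable_continuous g : continuous g ->
  measurable_fun setT (g : borel_invlim S -> R).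
Proof.
move=> /continuousP cg.
apply: (measurability _ (measurable_realfun.RGenOpens.measurableE R)).
move=> _ [_ [a [b ->] <-]]; rewrite setTI; apply: sub_sigma_algebra.
exact/cg/interval_open.
Qed.

Lemma integrable_continuous mu g : continuous g ->
  mu.-integrable setT (EFin \o (g : borel_invlim S -> R)).
Proof.
move=> cg; apply: measurable_bounded_integrable => //.
- by rewrite -ge0_fin_numE//; exact: fin_num_measure.
- exact: measurable_continuous.
have [n gn] := continuous_uniform cg ltr01.
pose t (e : edge (S n)) := sval (cid (edge_at_surj e)).
have tE e : edge_at n (t e) = e by rewrite /t; case: cid.
exists (1 + \sum_e `|g (t e)|); split; first exact: num_real.
move=> M /ltW leM x _; apply: le_trans leM.
rewrite -(subrK (g (t (edge_at n x))) (g x)) (le_trans (ler_normD _ _))//.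
apply: lerD; first by apply: gn; rewrite tE.
by rewrite (bigD1 (edge_at n x))//= lerDl sumr_ge0.
Qed.

Lemma Rintegral_edge_at mu n (h : edge (S n) -> R) :
  (\int[mu]_x h (edge_at n x) = \sum_e h e * edge_weights mu e)%R.
Proof.
have hE (x : borel_invlim S) : (h (edge_at n x))%:E =
    (\sum_e (h e * \1_(cyl_edge e) x)%:E)%E.
  rewrite (bigD1 (edge_at n x))//= big1 ?adde0 => [|e ex].
    by rewrite indicE mem_set ?mulr1 ?cyl_edgeE.
  by rewrite indicE memNset ?mulr0// cyl_edgeE => /= xe; rewrite xe eqxx in ex.
have mcyl (e : edge (S n)) : measurable (cyl_edge e : set (borel_invlim S)).
  by rewrite cyl_edgeE; exact: measurable_edge_at.
have icyl (e : edge (S n)) :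
    mu.-integrable setT (fun x : borel_invlim S => (\1_(cyl_edge e) x : R)%:E).
  exact: integrable_indic.
rewrite /Rintegral (eq_integral _ _ (fun x _ => hE x)) integral_sum//; last first.
  move=> e; under eq_fun do rewrite EFinM.
  exact: integrableZl.
rewrite -[RHS]/(fine _%:E) -sumEFin; congr fine; apply: eq_bigr => e _.
under eq_integral do rewrite EFinM.
rewrite integralZl// integral_indic// setIT EFinM; congr (_ * _)%E.
exact/esym/fineK/(fin_num_measure mu).
Qed.

(** Replacing [g] on each cell by its value at a point of the cell changes it by at
    most [eps] everywhere. The level and the coefficients do not depend on the
    measure, which makes the estimate usable as the measure varies. *)
Lemma Rintegral_approx g (eps : R) : continuous g -> 0 < eps ->
  exists n (c : edge (S n) -> R), forall mu,
    `|(\int[mu]_x g x)%R - \sum_e c e * edge_weights mu e| <=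
    eps * \sum_(e : edge (S n)) edge_weights mu e.
Proof.
move=> cg eps0; have [n gn] := continuous_uniform cg eps0.
pose t (e : edge (S n)) := sval (cid (edge_at_surj e)).
have tE e : edge_at n (t e) = e by rewrite /t; case: cid.
exists n, (g \o t) => mu; rewrite -Rintegral_edge_at.
have cgt : continuous ((g \o t) \o edge_at n) by exact: continuous_edge_at.
have cB : continuous (fun y => g y - g (t (edge_at n y))).
  by move=> x; exact: (cvgB (cg x) (cgt x)).
have ig := integrable_continuous mu cg.
have igt := integrable_continuous mu cgt.
have iB := integrable_continuous mu cB.
rewrite -RintegralB//; apply: le_trans (le_normr_Rintegral _ iB) _ => //.
apply: (@le_trans _ _ (\int[mu]_(x in setT) eps)%R).
  apply: le_Rintegral => //.
  - have cn : continuous (fun x => `|g x - g (t (edge_at n x))|).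
      by move=> x; exact: (cvg_norm (cB x)).
    exact: (integrable_continuous mu cn).
  - have ce : continuous (cst eps : invlim S -> R) by exact: cst_continuous.
    exact: (integrable_continuous mu ce).
  - by move=> x _; apply: gn; rewrite tE.
by rewrite Rintegral_cst// -[leRHS]/(eps * fine _%:E) -(total_mass mu n).
Qed.

End integration.

(** * The homeomorphism *)

Section homeomorphism.
Variables (R : realType) (S : cover_seq).

(** The weight of [e] is the integral of the indicator of its cell, which is
    continuous because the cell is clopen. *)
Lemma continuous_edge_weights : continuous (@edge_weights R S).
Proof.
move=> mu; have FF : Filter (nbhs mu) by exact: nbhs_filter.
apply/prod_cvgP => n; apply/prod_cvgP => e.
pose h (f : edge (S n)) : R := (f == e)%:R.
have ch : continuous (h \o @edge_at S n) by exact: continuous_edge_at.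
have intE (nu : finmeas R S) : edge_weights nu e = integrals nu (exist _ _ ch).
  rewrite /integrals /= Rintegral_edge_at (bigD1 e)//= /h eqxx mul1r big1 ?addr0//.
  by move=> f /negbTE ->; rewrite mul0r.
suff : (fun nu => integrals nu (exist _ _ ch)) @ nbhs mu -->
    integrals mu (exist _ _ ch).
  rewrite -intE (_ : (fun nu => _) = fun nu => edge_weights nu e)//.
  by apply/funext => nu; rewrite intE.
have /(initial_cvgP (@integrals R S)) : nbhs mu --> (mu : finmeas R S).
  exact: cvg_id.
by move=> /prod_cvgP/(_ (exist _ _ ch)).
Qed.

Lemma continuous_chain_sum n (c : edge (S n) -> R) :
  continuous (fun x : chain_seq R S => \sum_e c e * x n e).
Proof.
apply: continuous_big => [|e _ x]; first exact: add_continuous.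
have /prod_cvgP/(_ n)/prod_cvgP/(_ e) xe : nbhs x --> (x : chain_seq R S).
  exact: cvg_id.
apply: (@continuous_comp _ _ _ (fun x : chain_seq R S => x n e)
  (fun r => c e * r)) => //.
exact: mulrl_continuous.
Qed.

(** By [Rintegral_approx] the weights control the integrals of measures whose total
    mass stays bounded, and the total mass is continuous in the weights. *)
Lemma continuous_edge_weights_inverse (B : set (chain_seq R S))
    (q : chain_seq R S -> finmeas R S) :
  (forall x, B x -> edge_weights (q x) = x) -> {within B, continuous q}.
Proof.
move=> qK; apply/subspace_continuousP => x Bx.
apply/(initial_cvgP (@integrals R S))/prod_cvgP => -[g cg].
apply/cvgrPdist_le => eps eps0; rewrite /integrals /=.
(* The factor 1 lets [continuous_chain_sum] apply to [T]. *)
pose T (y : chain_seq R S) : R := \sum_(e : edge (S 0)) 1 * y 0%N e.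
have TE y n : B y -> \sum_(e : edge (S n)) y n e = T y.
  move=> By; apply: EFin_inj; rewrite -(qK y By) -total_mass (total_mass _ 0).
  by congr EFin; apply: eq_bigr => e _; rewrite mul1r.
have Tge0 y : B y -> 0 <= T y.
  move=> By; apply: sumr_ge0 => e _; rewrite mul1r -(qK y By).
  exact: fine_ge0.
(* Near [x] the total mass stays below [T x + 1], so [d] makes each of the two
   approximation errors at most [eps / 4]. *)
pose d := eps / (4 * (T x + 1)).
have Tx0 := Tge0 x Bx.
have d0 : 0 < d by rewrite divr_gt0// mulr_gt0//; lra.
have dT : d * (T x + 1) = eps / 4.
  by rewrite /d invfM mulrA divfK// gt_eqF// ltr_wpDl.
have [n [c gc]] := Rintegral_approx cg d0.
pose L (y : chain_seq R S) : R := \sum_e c e * y n e.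
have gL y : B y -> `|(\int[q y]_z g z)%R - L y| <= d * T y.
  by move=> By; have := gc (q y); rewrite qK// TE.
have Lx : \forall y \near x, `|L x - L y| <= eps / 4.
  have /cvgrPdist_le := @continuous_chain_sum n c x; apply.
  by rewrite divr_gt0.
have Tx : \forall y \near x, `|T x - T y| <= 1.
  by have /cvgrPdist_le := @continuous_chain_sum 0 (fun=> 1) x; apply.
suff: \forall y \near within B (nbhs x),
    `|(\int[q x]_z g z)%R - (\int[q y]_z g z)%R| <= eps by [].
near=> y.
have By : B y by near: y; exact: withinT.
have Ly : `|L x - L y| <= eps / 4.
  by near: y; apply: cvg_within Lx.
have Ty : `|T x - T y| <= 1.
  by near: y; apply: cvg_within Tx.
have gx : `|(\int[q x]_z g z)%R - L x| <= eps / 4.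
  apply: le_trans (gL x Bx) _; rewrite -dT ler_pM2l//; lra.
have gy : `|(\int[q y]_z g z)%R - L y| <= eps / 4.
  apply: le_trans (gL y By) _; rewrite -dT ler_pM2l//.
  by move: Ty; rewrite ler_norml; lra.
move: gx gy Ly; rewrite !ler_norml.
move: (Rintegral _ _ _) (Rintegral _ _ _) (L x) (L y) => a b lx ly.
lra.
Unshelve. all: by end_near. Qed.

Lemma exists_edge_weights_inverse : exists q : chain_seq R S -> finmeas R S,
  forall x, limit_flows x -> invariant_measures (q x) /\ edge_weights (q x) = x.
Proof.
suff /choice[q qP] : forall x : chain_seq R S, exists mu : finmeas R S,
    limit_flows x -> invariant_measures mu /\ edge_weights mu = x by exists q.
move=> x; have [/edge_weights_surj[mu]|] := pselect (limit_flows x).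
  by exists mu.
by exists (mzero : finmeas R S).
Qed.

(** Both parts of the theorem are instances: all invariant measures with all limit
    flows, and the probability measures with the unit flows. *)
Lemma homeomorphic_edge_weights (A : set (finmeas R S)) (B : set (chain_seq R S)) :
  A `<=` @invariant_measures R S -> set_fun A B (@edge_weights R S) ->
  B `<=` @limit_flows R S ->
  (forall mu, invariant_measures mu -> B (edge_weights mu) -> A mu) ->
  set_bij A B (@edge_weights R S) /\ homeomorphic_via A B (@edge_weights R S).
Proof.
move=> AI AB BF BA; have [q qP] := exists_edge_weights_inverse.
have qA x : B x -> A (q x).
  by move=> Bx; have [qI qE] := qP x (BF x Bx); apply: BA => //; rewrite qE.
have qK x : B x -> edge_weights (q x) = x by move=> /BF/qP[].
have inj : {in A &, injective (@edge_weights R S)}.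
  by move=> mu nu /set_mem/AI[mu0 _] /set_mem/AI[nu0 _]; exact: finmeas_unique.
split; first split=> //.
  by move=> x Bx; exists (q x); [exact: qA|exact: qK].
split; first exact/continuous_subspaceT/continuous_edge_weights.
exists q; split=> //.
- move=> mu muA; apply: inj => //; last by rewrite qK//; exact/AB/set_mem.
  exact/mem_set/qA/AB/set_mem.
- by move=> x /set_mem; exact: qK.
- exact: continuous_edge_weights_inverse.
Qed.

Lemma edge_weights_limit_flows (mu : finmeas R S) :
  invariant_measures mu -> limit_flows (edge_weights mu).
Proof.
move=> [_ muI]; split; last exact: edge_weights_compatible.
by move=> n; exact: edge_weights_flows.
Qed.

End homeomorphism.

Theorem proposition4p15 (R : realType) (S : cover_seq) :
  [/\ set_bij (@invariant_measures R S) (@limit_flows R S) (@edge_weights R S),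
      forall (a b : {nonneg R}) (mu nu : finmeas R S),
        invariant_measures mu -> invariant_measures nu ->
        edge_weights (comb a b mu nu) =
        chain_comb a b (edge_weights mu) (edge_weights nu)
    & homeomorphic_via (@invariant_measures R S) (@limit_flows R S)
        (@edge_weights R S)] /\
  [/\ set_bij (@invariant_probabilities R S) (@limit_unit_flows R S)
        (@edge_weights R S),
      forall (a b : {nonneg R}) (mu nu : finmeas R S),
        a%:num + b%:num = 1 ->
        invariant_probabilities mu -> invariant_probabilities nu ->
        edge_weights (comb a b mu nu) =
        chain_comb a b (edge_weights mu) (edge_weights nu)
    & homeomorphic_via (@invariant_probabilities R S) (@limit_unit_flows R S)
        (@edge_weights R S)].
Proof.
have [bijM homM] := @homeomorphic_edge_weights R S _ (@limit_flows R S)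
  (fun _ h => h) (@edge_weights_limit_flows R S) (fun _ h => h) (fun _ h _ => h).
have [|||mu muI [muF _]|bijP homP] := @homeomorphic_edge_weights R S
  (@invariant_probabilities R S) (@limit_unit_flows R S).
- by move=> mu [].
- move=> mu [muI mu1]; have [muF muC] := edge_weights_limit_flows muI.
  split=> // n; split=> //; apply: EFin_inj.
  by rewrite -total_mass mu1.
- by move=> x [xF xC]; split=> // n; have [] := xF n.
- by split=> //; rewrite (total_mass mu 0); congr EFin; have [] := muF 0%N.
by split; split=> // a b mu nu *; exact: edge_weights_comb.
Qed.
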